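(* Let $E$ be an affine subspace of $\mathbb{S}^n$, let $U_*\in E\cap\mathbb{S}^n_+$, and let $B_1,\ldots,B_m$ be an orthogonal basis of the linear space $E-U_*=\{U-U_*: U\in E\}$. Define $\phi:\mathbb{R}^m\to E$ by $\phi(p)=U_*+\sum_{i=1}^m p_iB_i$ (a bijection). For $p\in\mathbb{R}^m$ let $\tilde p=\phi^{-1}\circ P_E\circ P_{\mathbb{S}^n_+}\circ\phi(p)$, and let $\lambda_1(p),\ldots,\lambda_n(p)$ be the eigenvalues of $\phi(p)$ (with multiplicity). Then $$\tilde p_i = p_i-\frac{1}{\|B_i\|^2}\frac{\partial}{\partial p_i}\sum_{\ell\in n(p)}\frac12\lambda_\ell^2(p),\qquad i=1,\ldots,m,$$ where $n(p)=\{\ell\in\{1,\ldots,n\}:\lambda_\ell(p)<0\}$.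
   Context: $\mathbb{S}^n$ is the space of real symmetric $n\times n$ matrices with inner product $\langle A,B\rangle=\operatorname{tr}(A^TB)$ and Frobenius norm $\|A\|=\sqrt{\langle A,A\rangle}$; $\mathbb{S}^n_+$ is the cone of positive semidefinite matrices. For a closed convex set $C\subset\mathbb{S}^n$, $P_C(A)$ is the unique nearest point of $C$ to $A$ in the Frobenius norm. ''Orthogonal basis'' means a basis of pairwise orthogonal (not necessarily normalized) elements. The partial derivative is that of the function $p\mapsto\sum_{\ell\in n(p)}\frac12\lambda_\ell^2(p)$ on $\mathbb{R}^m$ (the sum over the empty set being $0$). *)

(* Defs.v *)
From HB Require Import structures.
From mathcomp Require Import all_boot all_order all_algebra.
From mathcomp Require Import all_classical all_reals all_analysis.

Set Implicit Arguments.
Unset Strict Implicit.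
Unset Printing Implicit Defensive.

Import Order.TTheory GRing.Theory Num.Theory.
Import numFieldNormedType.Exports.
Local Open Scope classical_set_scope.
Local Open Scope ring_scope.

Section SymmetricMatrices.
Context {R : realType} {n : nat}.
Implicit Types (A X : 'M[R]_n) (C E S : set 'M[R]_n).

Definition mxdot A X : R := \tr (A^T *m X).

(* Not the norm `|A| of the library, which is the maximum of the absolute
   values of the entries. *)
Definition frobenius A : R := Num.sqrt (mxdot A A).

Definition Sym : set 'M[R]_n := [set A | A \is symmetricmx].

Definition SymPSD : set 'M[R]_n :=
  [set A | Sym A /\ forall x : 'cV[R]_n, 0 <= (x^T *m A *m x) 0 0].

(* The default value 0 is taken only if C has no nearest point to A, which
   does not happen when C is nonempty, closed and convex. *)
Definition nearest_point C A : 'M[R]_n :=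
  xget 0 [set X | C X /\ forall Y, C Y -> frobenius (A - X) <= frobenius (A - Y)].

Definition affine_subspace E : Prop :=
  exists (A : 'M[R]_n) (V : {vspace 'M[R]_n}), E = [set A + X | X in [set` V]].

Definition orthogonal_basis m S (B : m.-tuple 'M[R]_n) : Prop :=
  (exists2 V : {vspace 'M[R]_n}, S = [set` V] & basis_of V B) /\
  (forall i j : 'I_m, i != j -> mxdot (tnth B i) (tnth B j) = 0).

Definition eigenvalues_of A (lambda : 'I_n -> R) : Prop :=
  char_poly A = \prod_(l < n) ('X - (lambda l)%:P).

Definition phi m (U : 'M[R]_n) (B : m.-tuple 'M[R]_n) (p : 'rV[R]_m) : 'M[R]_n :=
  U + \sum_(i < m) p 0 i *: tnth B i.

(* 'pinv is the inverse of phi on its range; its default value 0 is taken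
   outside this range only. *)
Definition tilde m E (U : 'M[R]_n) (B : m.-tuple 'M[R]_n) (p : 'rV[R]_m) :
    'rV[R]_m :=
  'pinv_(fun=> 0) setT (phi U B)
    (nearest_point E (nearest_point SymPSD (phi U B p))).

Definition half_sum_sqr_neg m (lambda : 'rV[R]_m -> 'I_n -> R)
    (p : 'rV[R]_m) : R :=
  \sum_(l < n | lambda p l < 0) 2^-1 * lambda p l ^+ 2.

End SymmetricMatrices.

(* Main.v *)
(** Let P be the projection of A onto the cone of positive semidefinite matrices
and N = A - P.  Diagonalising A shows that P and N keep the nonnegative and the
negative eigenvalues of A, so the sum of the squared negative eigenvalues halved
is |N|^2 / 2, half the squared distance from A to the cone.  This function of A
is differentiable with gradient N: replacing A by A + H changes it by <N, H> up
to |H|^2 / 2.  Hence its i-th partial derivative in the coordinates p is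
<N, B_i>.  On the other hand, projecting onto E amounts to reading off the
coordinates <. - U, B_i> / |B_i|^2, and those of P and of A = P + N differ by
<N, B_i> / |B_i|^2. *)

Require Import Defs.
From HB Require Import structures.
From mathcomp Require Import all_boot all_order all_algebra.
From mathcomp Require Import all_classical all_reals all_analysis.
From mathcomp Require Import ring lra.

Set Implicit Arguments.
Unset Strict Implicit.
Unset Printing Implicit Defensive.

Import Order.TTheory GRing.Theory Num.Theory.
Import numFieldNormedType.Exports.
Local Open Scope classical_set_scope.
Local Open Scope ring_scope.

(** * Frobenius inner product and nearest points *)

Section FrobeniusInnerProduct.
Context {R : realType} {n : nat}.
Implicit Types A X Y Z : 'M[R]_n.

Lemma SymP A : Sym A <-> A^T = A.
Proof.
rewrite /Sym /= is_hermitianmxE expr0 scale1r map_mx_id //.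
by split => [/eqP/esym|->].
Qed.

Lemma mxdotE A X : mxdot A X = \sum_i \sum_j A i j * X i j.
Proof.
rewrite /mxdot /mxtrace exchange_big /=; apply: eq_bigr => j _.
by rewrite mxE; apply: eq_bigr => i _; rewrite mxE.
Qed.

Lemma mxdotC A X : mxdot A X = mxdot X A.
Proof. by rewrite /mxdot -mxtrace_tr trmx_mul trmxK. Qed.

Lemma mxdotDr A X Y : mxdot A (X + Y) = mxdot A X + mxdot A Y.
Proof. by rewrite /mxdot mulmxDr mxtraceD. Qed.

Lemma mxdotZr a A X : mxdot A (a *: X) = a * mxdot A X.
Proof. by rewrite /mxdot -scalemxAr mxtraceZ. Qed.

Lemma mxdotNr A X : mxdot A (- X) = - mxdot A X.
Proof. by rewrite -scaleN1r mxdotZr mulN1r. Qed.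

Lemma mxdotDl A X Y : mxdot (X + Y) A = mxdot X A + mxdot Y A.
Proof. by rewrite !(mxdotC _ A) mxdotDr. Qed.

Lemma mxdotZl a A X : mxdot (a *: X) A = a * mxdot X A.
Proof. by rewrite !(mxdotC _ A) mxdotZr. Qed.

Lemma mxdotNl A X : mxdot (- X) A = - mxdot X A.
Proof. by rewrite !(mxdotC _ A) mxdotNr. Qed.

Lemma mxdot_sumr (I : finType) A (F : I -> 'M[R]_n) :
  mxdot A (\sum_i F i) = \sum_i mxdot A (F i).
Proof. by rewrite /mxdot mulmx_sumr raddf_sum. Qed.

Lemma mxdot_ge0 A : 0 <= mxdot A A.
Proof.
by rewrite mxdotE; do 2 apply: sumr_ge0 => ? _; rewrite -expr2 sqr_ge0.
Qed.

Lemma mxdot_eq0 A : (mxdot A A == 0) = (A == 0).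
Proof.
apply/idP/eqP => [|->]; last by rewrite /mxdot mulmx0 mxtrace0.
rewrite mxdotE psumr_eq0 => [/allP A0|i _]; last first.
  by apply: sumr_ge0 => j _; rewrite -expr2 sqr_ge0.
apply/matrixP => i j; rewrite mxE; apply/eqP; rewrite -sqrf_eq0.
have := A0 i (mem_index_enum _); rewrite /= psumr_eq0 => [/allP/(_ j)|? _].
  by rewrite mem_index_enum expr2 => /(_ isT).
by rewrite -expr2 sqr_ge0.
Qed.

Lemma frobenius_sqr A : frobenius A ^+ 2 = mxdot A A.
Proof. by rewrite sqr_sqrtr // mxdot_ge0. Qed.

Lemma frobenius_le A X : (frobenius A <= frobenius X) = (mxdot A A <= mxdot X X).
Proof. by rewrite ler_sqrt // mxdot_ge0. Qed.

(** Obtuse-angle criterion. Expanding |A - Y|^2 around [X] gives |A - X|^2 + |Y - X|^2 plus a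
    nonnegative cross term, so [X] is a minimiser, and any other minimiser [Y] would satisfy |Y -
    X|^2 <= 0. Existence and uniqueness together exclude the default value of [nearest_point]. *)
Lemma nearest_pointP (C : set 'M[R]_n) A X :
  C X -> (forall Y, C Y -> mxdot (A - X) (Y - X) <= 0) -> nearest_point C A = X.
Proof.
move=> CX obt.
have split_dist Y : mxdot (A - Y) (A - Y) = mxdot (A - X) (A - X)
    - 2 * mxdot (A - X) (Y - X) + mxdot (Y - X) (Y - X).
  have -> : A - Y = (A - X) - (Y - X) by rewrite opprB addrA subrK.
  move: (A - X) (Y - X) => N D.
  by rewrite mxdotDr !mxdotDl !mxdotNr !mxdotNl (mxdotC D N); ring.
apply: xget_unique => [|Y [CY minY]].
  split=> // Y CY; rewrite frobenius_le (split_dist Y).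
  have := obt Y CY; have := mxdot_ge0 (Y - X); lra.
apply/eqP; rewrite -subr_eq0 -mxdot_eq0 eq_le mxdot_ge0 andbT.
have := minY X CX; rewrite frobenius_le (split_dist Y).
have := obt Y CY; lra.
Qed.

End FrobeniusInnerProduct.

(** * Spectral theorem for real symmetric matrices *)

Section RealSpectralTheorem.
Context {R : realType}.

(* H is the Householder reflection exchanging u and v. *)
Lemma householder (n : nat) (u v : 'rV[R]_n) : u *m u^T = v *m v^T ->
  exists H : 'M[R]_n, [/\ H^T = H, H *m H = 1%:M & u *m H = v].
Proof.
move=> uv; have [w wE] : exists w, w = u - v by exists (u - v).
pose s := (w *m w^T) 0 0; have wwE : w *m w^T = s%:M by rewrite [LHS]mx11_scalar.
(* Since |u| = |v|, both sides equal 2 |u|^2 - 2 <u, v>. *)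
have uwE : 2%:R *: (u *m w^T) = s%:M.
  rewrite -wwE wE linearB /= mulmxBl !mulmxBr -uv.
  have -> : v *m u^T = u *m v^T.
    rewrite -[LHS]trmxK trmx_mul trmxK; apply/matrixP => i j.
    by rewrite mxE !ord1.
  by rewrite scaler_nat mulr2n opprB.
have [s0|s0] := eqVneq s 0.
  have w0 : w = 0.
    apply/rowP => j; rewrite [RHS]mxE; apply/eqP; rewrite -sqrf_eq0.
    have : \sum_k w 0 k ^+ 2 == 0.
      apply/eqP; rewrite -[RHS]s0 /s mxE; apply: eq_bigr => k _.
      by rewrite expr2 [w^T _ _]mxE.
    rewrite psumr_eq0 => [/allP/(_ j)|? _]; last exact: sqr_ge0.
    by rewrite mem_index_enum => /(_ isT).
  exists 1%:M; rewrite trmx1 !mulmx1; split => //.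
  by apply/eqP; rewrite -subr_eq0 -wE w0.
exists (1%:M - (2 / s) *: (w^T *m w)); split.
- by rewrite linearB linearZ /= trmx1 trmx_mul trmxK.
- rewrite mulmxBl mul1mx mulmxBr mulmx1 -scalemxAl -scalemxAr -mulmxA.
  rewrite (mulmxA w) wwE mul_scalar_mx -scalemxAr !scalerA.
  have -> : 2 / s * (2 / s * s) = 2 / s + 2 / s by field.
  by rewrite scalerDl opprB addrK subrK.
- rewrite mulmxBr mulmx1 -scalemxAr mulmxA scalemxAl.
  have -> : (2 / s) *: (u *m w^T) = 1%:M.
    rewrite mulrC -scalerA -[2]/(2%:R) uwE.
    by rewrite -[LHS]mul_scalar_mx -scalar_mxM mulVf.
  by rewrite mul1mx wE subKr.
Qed.

Lemma char_poly_conj (n : nat) (A P Q : 'M[R]_n) : Q *m P = 1%:M ->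
  char_poly (P *m A *m Q) = char_poly A.
Proof.
move=> QP; have PQ := mulmx1C QP.
have -> : char_poly (P *m A *m Q) =
    \det (map_mx polyC P *m char_poly_mx A *m map_mx polyC Q).
  rewrite /char_poly /char_poly_mx mulmxBr mulmxBl !map_mxM /=; congr (\det (_ - _)).
  by rewrite scalar_mxC -mulmxA -map_mxM PQ map_mx1 mulmx1.
by rewrite !det_mulmx mulrAC -det_mulmx -map_mxM PQ map_mx1 det1 mul1r.
Qed.

Lemma char_poly_lblock (n1 n2 : nat) (A : 'M[R]_n1) (C : 'M[R]_(n2, n1))
    (D : 'M[R]_n2) :
  char_poly (block_mx A 0 C D) = char_poly A * char_poly D.
Proof.
rewrite /char_poly /char_poly_mx map_block_mx map_mx0 scalar_mx_block.
by rewrite opp_block_mx add_block_mx !oppr0 !add0r det_lblock.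
Qed.

(** Induction by deflation: a Householder reflection moves a unit row eigenvector for [l ord0] to
    the first basis vector, symmetry makes the conjugated matrix block diagonal, and the induction
    hypothesis treats the lower block. Peeling off the roots in the order of [l] makes the diagonal
    follow the given enumeration. *)
Lemma spectral_theorem (n : nat) (A : 'M[R]_n) (l : 'I_n -> R) :
  Sym A -> eigenvalues_of A l ->
  exists2 Q : 'M[R]_n, Q *m Q^T = 1%:M & A = Q^T *m diag_mx (\row_i l i) *m Q.
Proof.
elim: n => [|n IH] in A l * => /SymP symA charA.
  by exists 1%:M; [rewrite trmx1 mulmx1|rewrite [LHS]flatmx0 [RHS]flatmx0].
have /eigenvalueP[u0 u0A u0_neq0] : eigenvalue A (l ord0).
  rewrite eigenvalue_root_char charA /root horner_prod big_ord_recl.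
  by rewrite hornerXsubC subrr mul0r.
pose e : 'rV[R]_(1 + n) := row_mx 1%:M 0.
have eeT : e *m e^T = 1%:M.
  by rewrite /e tr_row_mx mul_row_col trmx0 mulmx0 addr0 trmx1 mulmx1.
set s := (u0 *m u0^T) 0 0.
have s_gt0 : 0 < s.
  have sE : s = \sum_j u0 0 j ^+ 2.
    by rewrite /s mxE; apply: eq_bigr => j _; rewrite mxE expr2.
  rewrite lt_neqAle eq_sym sE sumr_ge0 ?andbT => [|j _]; last exact: sqr_ge0.
  apply: contraNneq u0_neq0 => /eqP; rewrite psumr_eq0 => [/allP s0|? _].
    apply/eqP/rowP => j; rewrite [RHS]mxE; apply/eqP; rewrite -sqrf_eq0.
    exact: (s0 j (mem_index_enum _)).
  exact: sqr_ge0.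
(* Normalised to the length of [e], as [householder] requires. *)
pose u := (Num.sqrt s)^-1 *: u0.
have uA : u *m A = l ord0 *: u by rewrite -scalemxAl u0A scalerA mulrC -scalerA.
have uu : u *m u^T = e *m e^T.
  rewrite eeT linearZ /= -scalemxAl -scalemxAr [u0 *m _]mx11_scalar -/s scalerA.
  rewrite -invfM -expr2 sqr_sqrtr ?ltW //.
  by rewrite -[LHS]mul_scalar_mx -scalar_mxM mulVf ?gt_eqF.
have [H [symH HH uH]] := householder uu.
have eH : e *m H = u by rewrite -uH -mulmxA HH mulmx1.
pose M : 'M[R]_(1 + n) := H *m A *m H.
have symM : M^T = M by rewrite /M !trmx_mul symH symA mulmxA.
have eM : e *m M = l ord0 *: e by rewrite /M !mulmxA eH uA -scalemxAl uH.
(* [e *m M] is the first row of [M]; symmetry then clears the first column below the corner. *)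
have [ulM urM] : ulsubmx M = (l ord0)%:M /\ ursubmx M = 0.
  move: eM; rewrite -{1}[M]submxK /e mul_row_block !mul1mx !mul0mx !addr0.
  by rewrite scale_row_mx scaler0 -mul_scalar_mx mulmx1 => /eq_row_mx.
have dlM : dlsubmx M = 0 by rewrite -[M]symM -trmx_ursub urM trmx0.
pose M' := drsubmx M.
have ME : M = block_mx (l ord0)%:M 0 0 M' by rewrite -ulM -{1}urM -dlM submxK.
have symM' : Sym M' by apply/SymP; rewrite /M' trmx_drsub symM.
have charM' : eigenvalues_of M' (fun i => l (lift ord0 i)).
  have : char_poly M = char_poly A by rewrite /M char_poly_conj.
  rewrite ME char_poly_lblock charA big_ord_recl.
  have -> : char_poly ((l ord0)%:M : 'M[R]_1) = 'X - (l ord0)%:P.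
    by rewrite /char_poly det_mx11 !mxE.
  (* Cancelling the nonzero factor of [l ord0] leaves the factorisation for [M']. *)
  by move/mulfI; apply; rewrite polyXsubC_eq0.
have [Q' QQ' M'E] := IH M' _ symM' charM'.
pose Q0 : 'M[R]_(1 + n) := block_mx 1%:M 0 0 Q'.
have Q0T : Q0^T = block_mx 1%:M 0 0 Q'^T.
  by rewrite /Q0 tr_block_mx !trmx0 trmx1.
have Q0Q0 : Q0 *m Q0^T = 1%:M.
  rewrite Q0T /Q0 mulmx_block.
  by rewrite !mulmx0 !mul0mx !addr0 !add0r QQ' mulmx1 -scalar_mx_block.
have lE : (\row_i l i) = row_mx (\row__ l ord0) (\row_i l (lift ord0 i))
    :> 'rV[R]_(1 + n).
  apply/rowP => i; rewrite mxE; case: (split_ordP i) => j ->.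
    by rewrite row_mxEl mxE ord1; congr l; apply: val_inj.
  by rewrite row_mxEr mxE; congr l; apply: val_inj.
have MQ0 : M = Q0^T *m diag_mx (\row_i l i : 'rV[R]_(1 + n)) *m Q0.
  rewrite lE diag_mx_row Q0T /Q0 !mulmx_block.
  rewrite !(mulmx0, mul0mx, addr0, add0r, mulmx1, mul1mx) -M'E ME; congr block_mx.
  by apply/matrixP => i j; rewrite !mxE ord1 [j]ord1.
exists (Q0 *m H).
  by rewrite trmx_mul symH mulmxA -(mulmxA Q0) HH mulmx1; exact: Q0Q0.
have AE : A = H *m M *m H by rewrite /M !mulmxA HH mul1mx -mulmxA HH mulmx1.
by rewrite [LHS]AE MQ0 trmx_mul symH !mulmxA.
Qed.

End RealSpectralTheorem.

(** * Moreau decomposition and squared distance to the cone *)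

Section PositivePart.
Context {R : realType} {n : nat}.
Implicit Types A P Q X Y H : 'M[R]_n.

Lemma quad_conj_diag Q (a : 'rV[R]_n) (x : 'cV[R]_n) :
  (x^T *m (Q^T *m diag_mx a *m Q) *m x) 0 0 = \sum_i a 0 i * (Q *m x) i 0 ^+ 2.
Proof.
have -> : x^T *m (Q^T *m diag_mx a *m Q) *m x =
    (Q *m x)^T *m diag_mx a *m (Q *m x) by rewrite trmx_mul !mulmxA.
rewrite mxE; apply: eq_bigr => i _.
by rewrite mul_mx_diag mxE [_^T _ _]mxE mulrAC mulrC expr2.
Qed.

Lemma mxdot_conj_diag Q (a : 'rV[R]_n) X :
  mxdot (Q^T *m diag_mx a *m Q) X = \sum_i a 0 i * (Q *m X *m Q^T) i i.
Proof.
rewrite /mxdot !trmx_mul trmxK tr_diag_mx -(mulmxA Q^T) mxtrace_mulC -!mulmxA /mxtrace.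
by apply: eq_bigr => i _; rewrite mul_diag_mx mxE.
Qed.

(* Moreau's decomposition of A with respect to the self-dual cone SymPSD, the
   polar part being A - P. *)
Definition psd_part A P : Prop :=
  [/\ SymPSD P, mxdot (A - P) P = 0 &
      forall Y, SymPSD Y -> mxdot (A - P) Y <= 0].

Lemma exists_psd_part A (l : 'I_n -> R) : Sym A -> eigenvalues_of A l ->
  exists2 P, psd_part A P &
    mxdot (A - P) (A - P) = \sum_(i < n | l i < 0) l i ^+ 2.
Proof.
move=> symA charA; have [Q QQ AE] := spectral_theorem symA charA.
pose a : 'rV[R]_n := \row_i Num.max (l i) 0.
pose b : 'rV[R]_n := \row_i Num.min (l i) 0.
have APE : A - Q^T *m diag_mx a *m Q = Q^T *m diag_mx b *m Q.
  apply/eqP; rewrite subr_eq AE -mulmxDl -mulmxDr -linearD /=; apply/eqP.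
  congr (_ *m diag_mx _ *m _); apply/rowP => i.
  by rewrite !mxE addr_min_max addr0.
have QE (c : 'rV[R]_n) i : (Q *m (Q^T *m diag_mx c *m Q) *m Q^T) i i = c 0 i.
  by rewrite !mulmxA QQ mul1mx -mulmxA QQ mulmx1 mxE eqxx mulr1n.
exists (Q^T *m diag_mx a *m Q); rewrite /psd_part APE; last first.
  rewrite mxdot_conj_diag [RHS]big_mkcond; apply: eq_bigr => i _.
  by rewrite QE mxE; case: ltP => _; rewrite ?mulr0 // expr2.
split.
- split; first by apply/SymP; rewrite !trmx_mul trmxK tr_diag_mx mulmxA.
  move=> x; rewrite quad_conj_diag sumr_ge0 // => i _.
  by rewrite mulr_ge0 ?sqr_ge0 // mxE le_max lexx orbT.
- rewrite mxdot_conj_diag big1 // => i _; rewrite QE !mxE.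
  by case: ltP; rewrite ?mul0r ?mulr0.
- move=> Y [_ psdY]; rewrite mxdot_conj_diag sumr_le0 // => i _.
  apply: mulr_le0_ge0; first by rewrite mxE ge_min lexx orbT.
  (* The i-th diagonal entry of [Q *m Y *m Q^T] is the quadratic form of [Y] at the i-th row of
     [Q]. *)
  have := psdY (row i Q)^T; rewrite trmxK tr_row -row_mul colE mulmxA -row_mul -colE.
  by rewrite [(col _ _) _ _]mxE [(row _ _) _ _]mxE.
Qed.

(** As [A - P] is orthogonal to [P], the obtuse-angle criterion reduces to the polar inequality. *)
Lemma nearest_psd_part A P : psd_part A P -> nearest_point SymPSD A = P.
Proof.
case=> psdP AP0 polar; apply: nearest_pointP => // Y psdY.
by rewrite mxdotDr mxdotNr AP0 subr0 polar.
Qed.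

(* The upper bound compares A + H with the psd part of A; the lower bound is
   [0 <= |N' - N|^2] for the polar parts N and N' of A and A + H. *)
Lemma psd_part_dist_bound A H P P' : psd_part A P -> psd_part (A + H) P' ->
  let d X := 2^-1 * mxdot X X in
  0 <= d (A + H - P') - d (A - P) - mxdot (A - P) H <= 2^-1 * mxdot H H.
Proof.
case=> psdP AP polar [psdP' AP' polar'] /=.
have := polar _ psdP'; have := polar' _ psdP; move: AP AP'.
have [N NE] : exists N, N = A - P by exists (A - P).
have [N' N'E] : exists N', N' = A + H - P' by exists (A + H - P').
have P'E : P' = N + P + H - N' by rewrite N'E NE subrK opprB addrC subrK.
rewrite -NE -N'E P'E => AP.
(* [N + H - N'] is [P' - P]; its square serves the upper bound. With [P'] eliminated, both bounds
   are linear in the inner products of [N], [N'], [P] and [H]. *)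
have := mxdot_ge0 (N' - N); have := mxdot_ge0 (N + H - N').
rewrite !(mxdotDr, mxdotDl, mxdotNr, mxdotNl) AP.
rewrite (mxdotC N' N) (mxdotC H N) (mxdotC N' H); lra.
Qed.

End PositivePart.

(** After division by [t], the difference quotient is within [K * |t|] of [c]. The bound holds for
    every [t], so the radius 1 chosen in the proof is arbitrary. *)
Lemma quadratic_expansion_derive (R : realType) (V : normedModType R)
    (f : V -> R) (p v : V) (c K : R) :
  (forall t : R, 0 <= f (t *: v + p) - f p - t * c <= K * t ^+ 2) ->
  derivable f p v /\ 'D_v f p = c.
Proof.
move=> bnd.
have quot0 : (fun t : R => t^-1 *: (f (t *: v + p) - f p) - c) @ 0^' --> 0.
  apply: (@cvg_to_0_linear _ _ K 1) => // t /andP[]; rewrite normr_gt0 => t0 _.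
  have /andP[b0 bK] := bnd t.
  have -> : t^-1 *: (f (t *: v + p) - f p) - c =
      t^-1 * (f (t *: v + p) - f p - t * c) by rewrite /GRing.scale /=; field.
  rewrite normrM (ger0_norm b0) normfV ler_pdivrMl ?normr_gt0 //.
  by rewrite mulrCA -normrM -expr2 ger0_norm ?sqr_ge0.
have quot : (fun t : R => t^-1 *: (f (t *: v + p) - f p)) @ 0^' --> c.
  exact/subr_cvg0.
by split; [apply/cvg_ex; exists c|apply: cvg_lim].
Qed.

(** * Orthogonal coordinates on the affine subspace *)

Section AffineCoordinates.
Context {R : realType} {n m : nat}.
Context (E : set 'M[R]_n) (U : 'M[R]_n) (B : m.-tuple 'M[R]_n).
Context (basisB : orthogonal_basis [set X - U | X in E] B).
Implicit Types (p q : 'rV[R]_m) (X : 'M[R]_n).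

Lemma orthogonal_basis_neq0 i : mxdot (tnth B i) (tnth B i) != 0.
Proof.
have [[V _ /andP[_ freeB]] _] := basisB.
rewrite mxdot_eq0; apply: contraTneq freeB => Bi0.
apply/negP => /free_not0 /(_ (mem_tnth i B)).
by rewrite Bi0 eqxx.
Qed.

Lemma mxdot_phi i p : mxdot (tnth B i) (phi U B p - U) =
  p 0 i * mxdot (tnth B i) (tnth B i).
Proof.
have [_ orthB] := basisB.
rewrite /phi addrC addKr mxdot_sumr (bigD1 i) //= mxdotZr big1 ?addr0 // => j ji.
by rewrite mxdotZr orthB ?mulr0 // eq_sym.
Qed.

(** Pairing with [tnth B i] recovers the i-th coordinate, hence injectivity; surjectivity holds
    because [B] spans the direction space. *)
Lemma phi_bij : set_bij setT E (phi U B).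
Proof.
have [[V SV basV] _] := basisB.
have EV X : E X <-> X - U \in V.
  have -> : (X - U \in V : Prop) = [set` V] (X - U) by [].
  by rewrite -SV; split=> [EX|[Y EY /addIr <-//]]; exists X.
split.
- move=> p _; apply/EV; rewrite /phi addrC addKr memv_suml // => i _.
  by rewrite memvZ // (basis_mem basV) // mem_tnth.
- move=> p q _ _ pq; apply/rowP => i.
  by apply: (mulIf (orthogonal_basis_neq0 i)); rewrite -!mxdot_phi pq.
- move=> X /EV; rewrite -(span_basis basV) => /coord_span XU.
  exists (\row_i coord B i (X - U)) => //.
  rewrite /phi -[RHS](subrK U) [RHS]addrC [in RHS]XU; congr (_ + _).
  by apply: eq_bigr => i _; rewrite mxE (tnth_nth 0).
Qed.

(** With these coordinates the residual [X - phi U B q] is orthogonal to every basis element, hence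
    to all differences of points of [E], and the obtuse-angle criterion holds with equality. *)
Lemma nearest_point_phi X q :
  (forall i, q 0 i = mxdot (tnth B i) (X - U) / mxdot (tnth B i) (tnth B i)) ->
  nearest_point E X = phi U B q.
Proof.
move=> qE; have [phiE _ surj] := phi_bij.
have normal i : mxdot (X - phi U B q) (tnth B i) = 0.
  have -> : X - phi U B q = (X - U) - (phi U B q - U) by rewrite opprB addrA subrK.
  rewrite mxdotC mxdotDr mxdotNr mxdot_phi qE divfK ?subrr //.
  exact: orthogonal_basis_neq0.
apply: nearest_pointP => [|Y EY]; first exact: phiE.
have [r _ <-] := surj Y EY.
have -> : phi U B r - phi U B q = \sum_i (r 0 i - q 0 i) *: tnth B i.
  rewrite /phi opprD addrACA subrr add0r -sumrB.
  by apply: eq_bigr => i _; rewrite scalerBl.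
rewrite mxdot_sumr big1 // => i _.
by rewrite mxdotZr normal mulr0.
Qed.

Lemma phiD p i t : phi U B (t *: delta_mx 0 i + p) = phi U B p + t *: tnth B i.
Proof.
rewrite /phi -addrA; congr (_ + _).
rewrite (bigD1 i) //= [in RHS](bigD1 i) //= !mxE !eqxx mulr1 scalerDl.
rewrite [RHS]addrC addrA; congr (_ + _); apply: eq_bigr => j ji.
by rewrite !mxE (negPf ji) mulr0 add0r.
Qed.

Lemma tildeE p P i : nearest_point SymPSD (phi U B p) = P ->
  tilde E U B p 0 i =
    p 0 i - (mxdot (tnth B i) (tnth B i))^-1 *
            mxdot (phi U B p - P) (tnth B i).
Proof.
move=> PE; rewrite /tilde PE.
pose q : 'rV[R]_m :=
  \row_i (mxdot (tnth B i) (P - U) / mxdot (tnth B i) (tnth B i)).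
rewrite (@nearest_point_phi _ q) => [|j]; last by rewrite mxE.
have [_ inj _] := phi_bij.
(* The nearest point is [phi U B q], so injectivity of [phi] returns [q] and the default of ['pinv]
   is not reached. *)
rewrite pinvKV ?inE // mxE.
(* The first difference contributes [p 0 i], the second the correction term. *)
have -> : P - U = (phi U B p - U) - (phi U B p - P).
  by rewrite opprB [RHS]addrC addrA subrK.
rewrite mxdotDr mxdotNr mxdot_phi (mxdotC (phi U B p - P)).
by field; exact: orthogonal_basis_neq0.
Qed.

End AffineCoordinates.

Theorem proposition3p1 (R : realType) (n m : nat) (E : set 'M[R]_n)
    (Ustar : 'M[R]_n) (B : m.-tuple 'M[R]_n)
    (lambda : 'rV[R]_m -> 'I_n -> R) :
  affine_subspace E -> E `<=` Sym ->
  (E `&` SymPSD) Ustar ->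
  orthogonal_basis [set U - Ustar | U in E] B ->
  (forall p, eigenvalues_of (phi Ustar B p) (lambda p)) ->
  set_bij setT E (phi Ustar B) /\
  forall (p : 'rV[R]_m) (i : 'I_m),
    derivable (half_sum_sqr_neg lambda) p (delta_mx 0 i) /\
    tilde E Ustar B p 0 i =
      p 0 i - (frobenius (tnth B i) ^+ 2)^-1 *
              'D_(delta_mx 0 i) (half_sum_sqr_neg lambda) p.
Proof.
move=> _ symE _ basisB eigs; have bij := phi_bij basisB; split=> // p i.
have [phiE _ _] := bij.
have psd q : exists2 P, psd_part (phi Ustar B q) P &
    half_sum_sqr_neg lambda q =
    2^-1 * mxdot (phi Ustar B q - P) (phi Ustar B q - P).
  have [P psdP distP] := exists_psd_part (symE _ (phiE q I)) (eigs q).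
  by exists P => //; rewrite distP mulr_sumr.
have [P psdP distP] := psd p.
(* The slope and the constant come from [psd_part_dist_bound] with [H] equal to [t *: tnth B i]. *)
have [|drv ->] := @quadratic_expansion_derive _ _ (half_sum_sqr_neg lambda) p
  (delta_mx 0 i) (mxdot (phi Ustar B p - P) (tnth B i))
  (2^-1 * mxdot (tnth B i) (tnth B i)).
  move=> t; have [P' psdP' distP'] := psd (t *: delta_mx 0 i + p).
  rewrite distP distP'; move: psdP'; rewrite phiD => psdP'.
  have := psd_part_dist_bound psdP psdP'.
  by rewrite !mxdotZr mxdotZl => /andP[? ?]; apply/andP; split; lra.
split=> //; rewrite frobenius_sqr.
exact: tildeE (nearest_psd_part psdP).
Qed.
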